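(* On $(\mathbb C^2)^{\otimes3}$ (three parties, one qubit each) let $S_3=\mathrm{span}\{|000\rangle,\ |100\rangle-|010\rangle,\ |100\rangle+|010\rangle+|001\rangle\}$, a 3-dimensional subspace. Then $S_3$ is locally indistinguishable: no orthonormal basis of $S_3$ is perfectly distinguishable by LOCC.
   Context: ''Perfectly distinguishable by LOCC'': there is a finite-round protocol, in each round one party performing a local measurement and broadcasting the outcome, that identifies with probability 1 which state of the set was given. *)

(* Defs.v *)
From HB Require Import structures.
From mathcomp Require Import all_boot all_order all_algebra.
Set Implicit Arguments. Unset Strict Implicit. Unset Printing Implicit Defensive.
Import Order.TTheory GRing.Theory Num.Theory.
Local Open Scope ring_scope.

(* Three qubits: computational basis |abc> has index 4a + 2b + c in 'I_8;
   party p : 'I_3 owns bit (x / 2^(2-p)) mod 2 (party 0 = most significant). *)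
Definition qbit (p : 'I_3) (x : 'I_8) : 'I_2 := inord ((x %/ 2 ^ (2 - p)) %% 2)%N.

Section Defs.
Variable C : numClosedFieldType.

Definition adjmx m n (A : 'M[C]_(m, n)) : 'M[C]_(n, m) := (map_mx Num.conj A)^T.

(* A acting on the qubit of party p, identity on the other two: I (x) A (x) I etc. *)
Definition localop (p : 'I_3) (A : 'M[C]_2) : 'M[C]_8 :=
  \matrix_(x, y) if [forall q : 'I_3, (q != p) ==> (qbit q x == qbit q y)]
                 then A (qbit p x) (qbit p y) else 0.

(* A finite-round LOCC protocol: a finite tree; at each node one party p
   performs a local measurement with finitely many outcomes given by Kraus
   operators K_0..K_{n-1} on its qubit, broadcasts the outcome i, and the
   protocol continues with next i.  A leaf announces a guess g (index of the state). *)
Inductive protocol : Type :=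
| Leaf of 'I_3
| Node (p : 'I_3) (n : nat) (K : 'I_n -> 'M[C]_2) (next : 'I_n -> protocol).

Definition kraus n (K : 'I_n -> 'M[C]_2) : Prop :=
  \sum_(i < n) adjmx (K i) *m K i = 1%:M.

(* perfect P M b : protocol P is valid, and, started on the (unnormalised)
   post-measurement states M b_j, every leaf with guess g is reached with
   probability 0 from every b_j with j <> g (i.e. M_leaf b_j = 0). *)
Fixpoint perfect (P : protocol) (M : 'M[C]_8) (b : 'I_3 -> 'cV[C]_8) : Prop :=
  match P with
  | Leaf g => forall j : 'I_3, j != g -> M *m b j = 0
  | Node p n K next =>
      kraus K /\ forall i : 'I_n, perfect (next i) (localop p (K i) *m M) b
  end.

Definition locc_distinguishable (b : 'I_3 -> 'cV[C]_8) : Prop :=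
  exists P : protocol, perfect P 1%:M b.

Definition ket (k : nat) : 'rV[C]_8 := delta_mx 0 (inord k).

Definition S3mx : 'M[C]_(1 + (1 + 1), 8) :=
  col_mx (ket 0) (col_mx (ket 4 - ket 2) (ket 4 + ket 2 + ket 1)).

Definition inner (u v : 'cV[C]_8) : C := \sum_(k < 8) Num.conj (u k 0) * v k 0.

End Defs.

(* Main.v *)
(** The rows of the Kraus operators accumulated at the leaves of a protocol are
    product row vectors [r] with [\sum_r r^* r = 1], and a row at a leaf
    guessing [k] annihilates [b j] for [j != k]. As [b] is an orthonormal basis
    of [S3], on [S3] such a row is [c <b k|] with [c = r (b k)]; hence, with
    [b k = a|000> + x|100> + y|010> + z|001>] and [2 z = x + y], its entries are
      [r_000 = c a^*], [r_100 = c x^* + n], [r_010 = c y^* + n],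
      [r_001 = c z^* - 2 n].
    Products satisfy [r_110 r_000 = r_100 r_010] (and two similar relations).
    Weighting the conjugate of this relation by [c / c^*] and summing over the
    rows, the completeness relation at [b k] kills the left-hand side (the entry
    of [b k] at [|110>] is zero) and the terms linear in [n], which leaves
    [x y + Q = 0], [x z = 2 Q], [y z = 2 Q] for a common [Q]. Hence
    [x = y = z = 0] for every [k], so that all [b k] are parallel to [|000>]. *)
Require Import Defs.
From HB Require Import structures.
From mathcomp Require Import all_boot all_order all_algebra.
From mathcomp Require Import ring.
Set Implicit Arguments. Unset Strict Implicit. Unset Printing Implicit Defensive.
Import Order.TTheory GRing.Theory Num.Theory.
Local Open Scope ring_scope.

(** * Basis indices as bit strings *)

Lemma qbitE (p : 'I_3) (x : 'I_8) : qbit p x = (x %/ 2 ^ (2 - p) %% 2)%N :> nat.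
Proof. by rewrite /qbit inordK // ltn_mod. Qed.

Definition bits (x : 'I_8) : {ffun 'I_3 -> 'I_2} := [ffun p => qbit p x].

Lemma bits_inj : injective bits.
Proof.
move=> x y /ffunP e; apply: val_inj.
have h (p : 'I_3) : (x %/ 2 ^ (2 - p) %% 2 = y %/ 2 ^ (2 - p) %% 2)%N
  by rewrite -!qbitE; have := e p; rewrite !ffunE => ->.
have := (h (inord 0), h (inord 1), h (inord 2)).
rewrite !inordK //=.
by case: x y {e h} => [[|[|[|[|[|[|[|[|x]]]]]]]] hx] [[|[|[|[|[|[|[|[|y]]]]]]]] hy] //= [[]].
Qed.

Lemma bits_bij : bijective bits.
Proof. by apply: inj_card_bij bits_inj _; rewrite card_ffun !card_ord. Qed.

(** * Tensor-product operators and the rows at the leaves of a protocol *)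

Section Protocols.
Variable C : numClosedFieldType.
Implicit Types (A B : 'I_3 -> 'M[C]_2) (p : 'I_3) (K : 'M[C]_2).

Lemma adjmxM m n q (X : 'M[C]_(m, n)) (Y : 'M[C]_(n, q)) :
  adjmx (X *m Y) = adjmx Y *m adjmx X.
Proof. by rewrite /adjmx map_mxM trmx_mul. Qed.

(** The matrix of the tensor product of the three [A p] in the computational basis. *)
Definition prodop A : 'M[C]_8 :=
  \matrix_(x, y) \prod_p A p (qbit p x) (qbit p y).

Lemma eq_prodop A B : A =1 B -> prodop A = prodop B.
Proof. by move=> e; apply/matrixP=> x y; rewrite !mxE; apply: eq_bigr => q _; rewrite e. Qed.

Lemma prodopM A B : prodop A *m prodop B = prodop (fun p => A p *m B p).
Proof.
apply/matrixP=> x y; rewrite !mxE.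
under [RHS]eq_bigr do rewrite mxE.
(* A product over parties of sums over one bit is a sum over bit strings, and [bits] identifies
   these with the indices in ['I_8]. *)
rewrite bigA_distr_bigA /= (reindex bits); last exact: onW_bij bits_bij.
apply: eq_bigr => z _; rewrite !mxE -big_split /=.
by apply: eq_bigr => p _; rewrite ffunE.
Qed.

Lemma prodop1 : prodop (fun=> 1%:M) = 1%:M.
Proof.
apply/matrixP=> x y; rewrite !mxE; have [->|nxy] := eqVneq x y.
  by rewrite big1 // => p _; rewrite mxE eqxx.
have [p np] : exists p, qbit p x != qbit p y.
  apply/existsP; rewrite -negb_forall; apply: contraNN nxy => /forallP h.
  by apply/eqP/bits_inj/ffunP=> p; rewrite !ffunE; apply/eqP/h.
by rewrite (bigD1 p) //= mxE (negPf np) mul0r.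
Qed.

Lemma localopE p K : localop p K = prodop (fun q => if q == p then K else 1%:M).
Proof.
apply/matrixP=> x y; rewrite !mxE (bigD1 p) //= eqxx.
case: ifPn => [/forallP h|].
  rewrite big1 ?mulr1 // => q nqp; rewrite (negPf nqp) mxE.
  by have := h q; rewrite nqp /= => ->.
rewrite negb_forall => /existsP [q]; rewrite negb_imply => /andP [nqp nq].
by rewrite (bigD1 q) //= (negPf nqp) mxE (negPf nq) mul0r mulr0.
Qed.

Lemma localop1 p : localop p (1%:M : 'M[C]_2) = 1%:M.
Proof. by rewrite localopE -prodop1; apply: eq_prodop => q; rewrite if_same. Qed.

Lemma localopM p K1 K2 : localop p K1 *m localop p K2 = localop p (K1 *m K2).
Proof.
rewrite !localopE prodopM; apply: eq_prodop => q.
by case: ifP; rewrite ?mulmx1.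
Qed.

Lemma adj_localop p K : adjmx (localop p K) = localop p (adjmx K).
Proof.
apply/matrixP=> x y; rewrite !mxE.
rewrite (eq_forallb (P2 := fun q => (q != p) ==> (qbit q x == qbit q y))).
  by case: ifP => _; rewrite ?rmorph0 ?mxE.
by move=> q; rewrite (eq_sym (qbit q y)).
Qed.

Lemma localop_sum p n (K : 'I_n -> 'M[C]_2) :
  \sum_i localop p (K i) = localop p (\sum_i K i).
Proof.
apply/matrixP=> x y; rewrite summxE mxE summxE.
by under eq_bigr do rewrite mxE; case: ifP => // _; rewrite big1.
Qed.

Lemma kraus_localop p n (K : 'I_n -> 'M[C]_2) m (M : 'M[C]_(8, m)) : kraus K ->
  \sum_i adjmx (localop p (K i) *m M) *m (localop p (K i) *m M) = adjmx M *m M.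
Proof.
move=> hK; under eq_bigr do rewrite adjmxM adj_localop -mulmxA (mulmxA (localop _ _)) localopM.
by rewrite -mulmx_sumr -mulmx_suml localop_sum hK localop1 mul1mx.
Qed.

Definition product_row (r : 'rV[C]_8) : Prop :=
  exists f : 'I_3 -> 'I_2 -> C, r = \row_x \prod_p f p (qbit p x).

Lemma adjmx_mul_rows m n (M : 'M[C]_(m, n)) :
  \sum_i adjmx (row i M) *m row i M = adjmx M *m M.
Proof.
apply/matrixP=> x y; rewrite summxE mxE; apply: eq_bigr => i _.
by rewrite mxE big_ord1 !mxE.
Qed.

(** The induction runs over all [A], since a local operator is itself a [prodop] and keeps the
    accumulated operator a product. At a node, [kraus_localop] adds up the branches. *)
Lemma perfect_rows (P : protocol C) A b : perfect P (prodop A) b ->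
  exists L : seq ('I_3 * 'rV[C]_8),
    \sum_(l <- L) adjmx l.2 *m l.2 = adjmx (prodop A) *m prodop A /\
    forall l, l \in L ->
      product_row l.2 /\ forall j, j != l.1 -> l.2 *m b j = 0.
Proof.
elim: P A => [g|p n K next IH] A /=.
  move=> h; exists [seq (g, row x (prodop A)) | x <- enum 'I_8]; split.
    by rewrite big_map /= big_enum /= adjmx_mul_rows.
  move=> l /mapP [x _ ->] /=; split.
    exists (fun p => A p (qbit p x)); apply/rowP=> y; by rewrite !mxE.
  by move=> j /h hj; rewrite -row_mul hj row0.
case=> hK h.
have /fin_all_exists [L hL] i : exists L : seq ('I_3 * 'rV[C]_8),
    \sum_(l <- L) adjmx l.2 *m l.2 =
      adjmx (localop p (K i) *m prodop A) *m (localop p (K i) *m prodop A) /\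
    forall l, l \in L ->
      product_row l.2 /\ forall j, j != l.1 -> l.2 *m b j = 0.
  by have := h i; rewrite localopE prodopM; apply: IH.
exists (flatten [seq L i | i <- enum 'I_n]); split.
  rewrite big_flatten big_map big_enum /=.
  by under eq_bigr do rewrite (proj1 (hL _)); rewrite kraus_localop.
by move=> l /flatten_mapP [i _ /(proj2 (hL i))].
Qed.

End Protocols.

(** * Rows against the subspace, and the relations between their entries *)

Section Subspace.
Variable C : numClosedFieldType.

Local Notation "''e' k" := (inord k : 'I_8) (at level 0, k at level 0).

Lemma ketE k (x : 'I_8) : ket C k 0 x = (x == inord k)%:R.
Proof. by rewrite mxE eqxx. Qed.

Lemma inord8_eq i j : (i < 8)%N -> (j < 8)%N -> ('e i == 'e j) = (i == j).
Proof. by move=> hi hj; rewrite -val_eqE /= !inordK. Qed.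

Lemma S3mx_coords (v : 'cV[C]_8) : (v^T <= S3mx C)%MS ->
  [/\ v 'e 4 0 + v 'e 2 0 = 2 * v 'e 1 0,
      v 'e 6 0 = 0, v 'e 5 0 = 0, v 'e 3 0 = 0 & v 'e 7 0 = 0].
Proof.
case/submxP=> D.
rewrite -[D]hsubmxK -[rsubmx D]hsubmxK /S3mx !mul_row_col => /rowP h.
have {}h k : v 'e k 0 = lsubmx D 0 0 * ket C 0 0 'e k
   + (lsubmx (rsubmx D) 0 0 * (ket C 4 0 'e k - ket C 2 0 'e k)
   + rsubmx (rsubmx D) 0 0 * (ket C 4 0 'e k + ket C 2 0 'e k + ket C 1 0 'e k)).
  by have := h 'e k; rewrite mxE => ->; rewrite !mxE !big_ord1 !mxE.
rewrite !h !ketE !inord8_eq //=.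
by split; ring.
Qed.

Lemma S3mx_ker (w : 'cV[C]_8) : S3mx C *m w = 0 ->
  [/\ w 'e 0 0 = 0, w 'e 2 0 = w 'e 4 0 & w 'e 1 0 = - 2 * w 'e 4 0].
Proof.
have ketM k : (ket C k *m w) 0 0 = w 'e k 0.
  rewrite mxE (bigD1 'e k) //= ketE eqxx mul1r big1 ?addr0 // => x nx.
  by rewrite ketE (negPf nx) mul0r.
rewrite /S3mx !mul_col_mx => h.
have : col_mx (ket C 0 *m w) (col_mx ((ket C 4 - ket C 2) *m w)
   ((ket C 4 + ket C 2 + ket C 1) *m w)) = col_mx 0 (col_mx 0 0).
  by rewrite h !col_mx0.
case/eq_col_mx => h0 /eq_col_mx [h1 h2].
have mulD (u v : 'rV[C]_8) : ((u + v) *m w) 0 0 = (u *m w) 0 0 + (v *m w) 0 0.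
  by rewrite mulmxDl mxE.
move: h0 h1 h2 => /matrixP /(_ 0 0) h0 /matrixP /(_ 0 0) h1 /matrixP /(_ 0 0) h2.
move: h0 h1 h2; rewrite !mulD mulNmx [(- _ : 'M_1) 0 0]mxE !ketM [(0 : 'M_1) 0 0]mxE.
move=> h0 /subr0_eq h1 h2; split=> //.
by apply/eqP; rewrite -subr_eq0 -h2 -h1; apply/eqP; ring.
Qed.

(** In each relation both pairs of indices carry the same two bits at every party, so the same six
    factors occur on either side. *)
Lemma product_row_rel (r : 'rV[C]_8) : product_row r ->
  [/\ r 0 'e 6 * r 0 'e 0 = r 0 'e 4 * r 0 'e 2,
      r 0 'e 5 * r 0 'e 0 = r 0 'e 4 * r 0 'e 1 &
      r 0 'e 3 * r 0 'e 0 = r 0 'e 2 * r 0 'e 1].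
Proof.
case=> f ->; rewrite !mxE !big_ord_recl !big_ord0 /qbit /= !inordK //=.
split; ring.
Qed.

Lemma S3_basis_row (b : 'I_3 -> 'cV[C]_8) k (r : 'rV[C]_8) :
  (forall i, ((b i)^T <= S3mx C)%MS) ->
  (forall i j, inner (b i) (b j) = (i == j)%:R) ->
  (forall j, j != k -> r *m b j = 0) ->
  S3mx C *m (r^T - (r *m b k) 0 0 *: map_mx Num.conj (b k)) = 0.
Proof.
move=> hS hI hr.
pose B : 'M[C]_(1 + (1 + 1), 8) := \matrix_i (b i)^T.
have [D hD] : exists D, B = D *m S3mx C.
  by apply/submxP/row_subP=> i; rewrite rowK.
have hB : B *m adjmx B = 1%:M.
  apply/matrixP=> i j; rewrite !mxE eq_sym -hI /inner; apply: eq_bigr => x _.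
  by rewrite !mxE mulrC.
(* [adjmx B *m B] is the projector onto the span of the basis: [D] is a left inverse of the square
   matrix [S3mx C *m adjmx B], hence also a right inverse. *)
have hSB : S3mx C *m adjmx B *m B = S3mx C.
  have : S3mx C *m adjmx B *m D = 1%:M.
    by apply: mulmx1C; rewrite mulmxA -hD.
  by rewrite {3}hD mulmxA => ->; rewrite mul1mx.
rewrite mulmxBr -{1}hSB -!mulmxA.
have -> : B *m r^T = (r *m b k) 0 0 *: delta_mx k 0.
  apply/colP=> j; transitivity ((r *m b j) 0 0).
    by rewrite !mxE; apply: eq_bigr => x _; rewrite !mxE mulrC.
  rewrite [RHS]mxE [delta_mx _ _ _ _]mxE eqxx andbT.
  by have [->|/hr ->] := eqVneq j k; rewrite ?mulr1 // mxE mulr0.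
rewrite -!scalemxAr -colE.
have -> : col k (adjmx B) = map_mx Num.conj (b k).
  by apply/colP=> x; rewrite !mxE.
exact: subrr.
Qed.

(* The relation between three product entries, weighted by [c / c^*]. When
   [c = 0] every term vanishes, since then [c / c^* = 0]. *)
Lemma weighted_relation (c n a u v r s t : C) :
  r * (c * Num.conj a) = (c * Num.conj u + s * n) * (c * Num.conj v + t * n) ->
  s \is Num.real -> t \is Num.real ->
  a * (Num.conj r * c) = u * v * (Num.conj c * c) +
    (s * v + t * u) * (Num.conj n * c) + s * t * (Num.conj n ^+ 2 * (c / Num.conj c)).
Proof.
move=> e /CrealP hs /CrealP ht; have [->|nc] := eqVneq c 0.
  by rewrite mul0r !mulr0 !addr0.
have nc' : Num.conj c != 0 by rewrite conjC_eq0.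
apply: (mulIf nc').
have := congr1 Num.conj e; rewrite !(rmorphM, rmorphD) /= !conjCK hs ht => e'.
transitivity (c * (Num.conj r * (Num.conj c * a))); first by ring.
by rewrite e'; field.
Qed.

Lemma S3_row_trivial (b : 'cV[C]_8) (L : seq 'rV[C]_8) :
  (b^T <= S3mx C)%MS -> inner b b = 1 ->
  (forall x, \sum_(r <- L) Num.conj (r 0 x) * (r *m b) 0 0 = b x 0) ->
  (forall r, r \in L -> product_row r /\
     S3mx C *m (r^T - (r *m b) 0 0 *: map_mx Num.conj b) = 0) ->
  [/\ b 'e 4 0 = 0, b 'e 2 0 = 0 & b 'e 1 0 = 0].
Proof.
move=> /S3mx_coords [hb h6 h5 h3 _] hbb hsum hL.
pose c (r : 'rV[C]_8) : C := (r *m b) 0 0.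
pose n (r : 'rV[C]_8) := r 0 'e 4 - c r * Num.conj (b 'e 4 0).
pose Q := \sum_(r <- L) Num.conj (n r) ^+ 2 * (c r / Num.conj (c r)).
have hr r : r \in L -> [/\ r 0 'e 0 = c r * Num.conj (b 'e 0 0),
    r 0 'e 4 = c r * Num.conj (b 'e 4 0) + 1 * n r,
    r 0 'e 2 = c r * Num.conj (b 'e 2 0) + 1 * n r &
    r 0 'e 1 = c r * Num.conj (b 'e 1 0) + - 2 * n r].
  case/hL=> _; rewrite -/(c r) => /S3mx_ker; rewrite !mxE -/(n r) => -[/subr0_eq e0 e2 e1].
  split=> //; first by rewrite /n; ring.
    by rewrite mul1r -e2; ring.
  by rewrite -e1; ring.
have W : \sum_(r <- L) Num.conj (c r) * c r = 1.
  rewrite -hbb /inner; under [RHS]eq_bigr do rewrite -[X in _ * X]hsum mulr_sumr.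
  rewrite exchange_big; apply: eq_bigr => r _ /=.
  under [RHS]eq_bigr do rewrite mulrA.
  rewrite -mulr_suml -/(c r); congr (_ * _).
  rewrite /c mxE rmorph_sum /=; apply: eq_bigr => x _.
  by rewrite rmorphM mulrC.
(* Completeness at the entry |100> gives [b 'e 4 0], and by [W] the subtracted part of [n] gives the
   same. *)
have N : \sum_(r <- L) Num.conj (n r) * c r = 0.
  under eq_bigr do rewrite rmorphB rmorphM /= conjCK mulrBl -mulrA mulrCA.
  by rewrite sumrB hsum -mulr_sumr W mulr1 subrr.
have key x s t u v : s \is Num.real -> t \is Num.real -> b x 0 = 0 ->
    (forall r, r \in L -> r 0 x * (c r * Num.conj (b 'e 0 0)) =
      (c r * Num.conj u + s * n r) * (c r * Num.conj v + t * n r)) ->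
    u * v + s * t * Q = 0.
  move=> hs ht hx h.
  have : b 'e 0 0 * (\sum_(r <- L) Num.conj (r 0 x) * c r) = 0 by rewrite hsum hx mulr0.
  rewrite mulr_sumr big_seq.
  under eq_bigr do rewrite (weighted_relation (h _ _)) //.
  by rewrite -big_seq !big_split /= -!mulr_sumr W N -/Q mulr1 mulr0 addr0.
have r1 : (1 : C) \is Num.real by exact: rpred1.
have r2 : (-2 : C) \is Num.real by rewrite rpredN realn.
have k1 : b 'e 4 0 * b 'e 2 0 + 1 * 1 * Q = 0.
  apply: key h6 _ => // r hrL; have [e0 e4 e2 e1] := hr r hrL.
  by rewrite -e0 -e4 -e2; case: (product_row_rel (proj1 (hL r hrL))).
have k2 : b 'e 4 0 * b 'e 1 0 + 1 * - 2 * Q = 0.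
  apply: key h5 _ => // r hrL; have [e0 e4 e2 e1] := hr r hrL.
  by rewrite -e0 -e4 -e1; case: (product_row_rel (proj1 (hL r hrL))).
have k3 : b 'e 2 0 * b 'e 1 0 + 1 * - 2 * Q = 0.
  apply: key h3 _ => // r hrL; have [e0 e4 e2 e1] := hr r hrL.
  by rewrite -e0 -e2 -e1; case: (product_row_rel (proj1 (hL r hrL))).
clear - hb k1 k2 k3.
move: (b 'e 4 0) (b 'e 2 0) (b 'e 1 0) hb k1 k2 k3 => x y z hz k1 k2 k3.
have n2 : (2 : C) != 0 by rewrite pnatr_eq0.
(* If [z] were nonzero, [k2] and [k3] would give [x = y], so [x = y = z] by [hz]; then twice [k1]
   plus [k2] reads [3 * z ^+ 2 = 0]. *)
have z0 : z = 0.
  apply/eqP; rewrite -[_ == 0]negbK; apply/negP => nz.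
  have xy : x = y by apply: (mulIf nz); apply: (addIr (1 * -2 * Q)); rewrite k2 k3.
  have xz : x = z by apply: (mulfI n2); rewrite -hz -xy; ring.
  have : 3 * z ^+ 2 = 2 * (x * y + 1 * 1 * Q) + (x * z + 1 * - 2 * Q).
    by rewrite -xy xz; ring.
  rewrite k1 k2 mulr0 addr0 => /eqP; rewrite mulf_eq0 pnatr_eq0 /= expf_eq0 /=.
  by rewrite (negPf nz).
move: k2; rewrite z0 mulr0 add0r mul1r => /eqP.
rewrite mulf_eq0 oppr_eq0 (negPf n2) /= => /eqP Q0.
have yx : y = - x by apply/eqP; rewrite -addr_eq0 addrC hz z0 mulr0.
move: k1; rewrite Q0 mulr0 addr0 yx mulrN => /eqP; rewrite oppr_eq0 mulf_eq0 orbb.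
by move/eqP=> ->; rewrite oppr0.
Qed.

End Subspace.

Theorem theorem6 (C : numClosedFieldType) (b : 'I_3 -> 'cV[C]_8) :
  (forall i : 'I_3, ((b i)^T <= S3mx C)%MS) ->
  (forall i j : 'I_3, inner (b i) (b j) = (i == j)%:R) ->
  ~ locc_distinguishable b.
Proof.
move=> hS hI [P]; rewrite -prodop1 => /perfect_rows [L []].
rewrite prodop1 mulmx1 => hsum hL.
have h1 : adjmx 1%:M = 1%:M :> 'M[C]_8 by rewrite /adjmx map_mx1 trmx1.
have triv k : [/\ b k (inord 4) 0 = 0, b k (inord 2) 0 = 0 & b k (inord 1) 0 = 0].
  (* Leaves with another guess have rows that annihilate [b k], so completeness at [b k] survives
     their removal. *)
  apply: (@S3_row_trivial _ _ [seq l.2 | l <- L & l.1 == k]); rewrite ?hI ?eqxx //.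
    move=> x; rewrite big_map big_filter.
    transitivity (((\sum_(l <- L) adjmx l.2 *m l.2) *m b k) x 0); last first.
      by rewrite hsum h1 mul1mx.
    rewrite mulmx_suml summxE [RHS](bigID (fun l => l.1 == k)) /=.
    rewrite [X in _ = _ + X]big_seq_cond [X in _ = _ + X]big1 ?addr0.
      by apply: eq_bigr => l _; rewrite -mulmxA [RHS]mxE big_ord1 !mxE.
    move=> l /andP [/hL [_ h] nl]; rewrite -mulmxA h 1?eq_sym //.
    by rewrite mulmx0 mxE.
  move=> r /mapP [l]; rewrite mem_filter => /andP [/eqP <- /hL [hp h]] ->.
  by split=> //; apply: S3_basis_row.
have in0 i j : inner (b i) (b j) = Num.conj (b i (inord 0) 0) * b j (inord 0) 0.
  rewrite /inner (bigD1 (inord 0)) //= big1 ?addr0 // => x nx.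
  have [h4 h2 h1'] := triv j; have [_ h6 h5 h3 h7] := S3mx_coords (hS j).
  suff -> : b j x 0 = 0 by rewrite mulr0.
  move: nx; rewrite -[x]inord_val.
  by case: x => [[|[|[|[|[|[|[|[|x]]]]]]]] hx] //=; rewrite eqxx.
have n0 i : b i (inord 0) 0 != 0.
  by apply/eqP=> e; have := hI i i; rewrite in0 e mulr0 eqxx => /eqP; rewrite eq_sym oner_eq0.
(* Two multiples of |000>, nonzero by normalisation, cannot be orthogonal. *)
have := hI (inord 0) (inord 1); rewrite in0 -val_eqE /= !inordK //= => /eqP.
by rewrite mulf_eq0 conjC_eq0 !(negPf (n0 _)).
Qed.
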